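(* Let $S$ be a complete semiring, $(\mathbf{C},\otimes,I)$ a small strict monoidal category, and $\mathcal{F}$ a system of fields. The state module $Z(M)$ of a closed $n$-dimensional manifold $M$ becomes a Frobenius semialgebra over $Q^m$ and over $Q^c$ when endowed with the counit functional $$\epsilon=\epsilon_M:Z(M)\to Q,\qquad \epsilon(z)=\sum_{f\in\mathcal{F}(M)}z(f).$$
   Context: A semiring $(S,+,\cdot,0,1)$ consists of a commutative monoid $(S,+,0)$ and a (not necessarily commutative) monoid $(S,\cdot,1)$ such that $\cdot$ distributes over $+$ from both sides and $0$ is absorbing. A complete monoid is a commutative monoid $(M,+,0)$ with a summation law assigning to every family $(m_i)_{i\in I}$, $I$ an arbitrary set, an element $\sum_{i\in I}m_i$ such that $\sum_{i\in\varnothing}m_i=0$, $\sum_{i\in\{1\}}m_i=m_1$, $\sum_{i\in\{1,2\}}m_i=m_1+m_2$, and $\sum_{j\in J}\big(\sum_{i\in I_j}m_i\big)=\sum_{i\in I}m_i$ for every partition $I=\bigcup_{j\in J}I_j$. A semiring is complete if $(S,+,0,\sum)$ is a complete monoid and $\sum_i ss_i=s\sum_i s_i$, $\sum_i s_is=(\sum_i s_i)s$. $Q=Q_S(\mathbf{C})$ is the complete monoid of functions $\operatorname{Mor}(\mathbf{C})\to S$ with pointwise addition and summation. It carries two complete semiring structures: $Q^c=(Q,+,\cdot,0,1)$ with $(a\cdot b)(\gamma)=\sum_{\beta\circ\alpha=\gamma}b(\beta)a(\alpha)$ and $1$ the characteristic function of the set of identity morphisms; $Q^m=(Q,+,\times,0,1^\times)$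 with $(a\times b)(\gamma)=\sum_{\alpha\otimes\beta=\gamma}b(\beta)a(\alpha)$ and $1^\times$ the characteristic function of $\operatorname{id}_I$. A two-sided $R$-semialgebra ($R$ a semiring) is a semiring $A$ which is also an $R$-$R$-bisemimodule with $r(ab)=(ra)b$ and $(ab)r=a(br)$. A Frobenius semialgebra over $R$ is a two-sided $R$-semialgebra $A$ together with an $R$-bisemimodule homomorphism $\epsilon:A\to R$ (the counit functional) such that the form $A\times A\to R$, $(a,b)\mapsto\epsilon(a\cdot b)$, is nondegenerate: for every nonzero $a\in A$ there is $b\in A$ with $\epsilon(ab)\ne 0$, and for every nonzero $b\in A$ there is $a\in A$ with $\epsilon(ab)\neq 0$. Fix an integer $n\ge 0$. Manifolds are topological and need not be orientable; $\varnothing$ is a manifold of every dimension; $\sqcup$ is the ordered disjoint union. A bordism from $M$ to $N$ is a triple $(W,M,N)$ (often abbreviated $W$) with $W$ a compact $(n+1)$-dimensional topological manifold, $\partial W=M\sqcup N$, where the closed $n$-manifolds $M,N$ are the incoming and outgoing boundary. $(W,M,N)\sqcup(W',M',N')=(W\sqcup W',M\sqcup M',N\sqcup N')$. If $W'$ is a bordism from $M$ to $N$ and $W''$ a bordism from $N$ to $P$, gluing along $N$ yields the bordism $W'\cup_N W''$ from $M$ to $P$. A homeomorphism of bordisms is a homeomorphism preserving incoming and outgoing boundaries. $(W_0,M_0,N_0)$ is a subbordism of $(W,M,N)$ if $W_0\subset W$ is a codimension $0$ submanifold, every connected component $C$ of $M_0$ satisfies $C\cap\partial W=\varnothing$ or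 $C\subset M$, and every connected component $C$ of $N_0$ satisfies $C\cap\partial W=\varnothing$ or $C\subset N$. A system $\mathcal{F}$ of fields assigns to each bordism $W$ a set $\mathcal{F}(W)$ and to each closed $n$-manifold $M$ a set $\mathcal{F}(M)$, with $\mathcal{F}(\varnothing)$ a one-element set, such that: (FRES) There are restriction maps $\mathcal{F}(W)\to\mathcal{F}(W_0)$ for subbordisms $W_0\subset W$, $\mathcal{F}(M)\to\mathcal{F}(M_0)$ for codimension $0$ submanifolds $M_0\subset M$, and $\mathcal{F}(W)\to\mathcal{F}(M)$ for closed codimension $1$ submanifolds $M\subset W$; they are written $f\mapsto f|_{(-)}$ and commute with each other in the obvious way (restricting in stages equals restricting directly). (FHOMEO) A homeomorphism of bordisms $\phi:W\to W'$ induces a bijection $\phi^*:\mathcal{F}(W')\to\mathcal{F}(W)$ with $(\operatorname{id}_W)^*=\operatorname{id}$, $(\psi\circ\phi)^*=\phi^*\circ\psi^*$; similarly for homeomorphisms of closed $n$-manifolds; these maps commute with the restriction maps. (FDISJ) The products of restrictions $\mathcal{F}(W\sqcup W')\to\mathcal{F}(W)\times\mathcal{F}(W')$ and $\mathcal{F}(M\sqcup N)\to\mathcal{F}(M)\times\mathcal{F}(N)$ are bijections. (FGLUE) For $W=W'\cup_N W''$, the map $\mathcal{F}(W)\to\mathcal{F}(W')\times_{\mathcal{F}(N)}\mathcal{F}(W'')$ given by the restrictions to $W'$ and $W''$ is a bijection onto the pullback. For a closed $n$-manifold $M$, the state module $Z(M)$ is the set of functions $z:\mathcal{F}(M)\to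 Q$ with $z(\phi^*f)=z(f)$ for all $f\in\mathcal{F}(M)$ and all homeomorphisms $\phi:M\to M$ isotopic to the identity. With pointwise operations and scalar multiplications it is a two-sided $Q^c$-semialgebra (using $\cdot$) and a two-sided $Q^m$-semialgebra (using $\times$). *)

(* Defs.v *)
From HB Require Import structures.
From mathcomp Require Import all_boot all_order all_algebra.
From mathcomp Require Import all_classical all_reals topology.
Import Order.TTheory GRing.Theory Num.Theory.
Import numFieldTopology.Exports.

Set Implicit Arguments.
Unset Strict Implicit.
Unset Printing Implicit Defensive.

Local Open Scope classical_set_scope.
Local Open Scope ring_scope.

(* Families are indexed by arbitrary types.  The one- and two-element axioms
   hold for every index type with exactly one (two) elements, so the value of a
   sum does not depend on how the indices are named.  A partition of I indexed
   by J is the family of fibres of a map I -> J; blocks may be empty. *)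
HB.mixin Record isCompleteMonoid M & GRing.Nmodule M := {
  csum : forall I : Type, (I -> M) -> M;
  csum_empty : forall (I : Type) (m : I -> M),
    (I -> False) -> csum I m = 0;
  csum_singleton : forall (I : Type) (i0 : I) (m : I -> M),
    (forall i, i = i0) -> csum I m = m i0;
  csum_pair : forall (I : Type) (i0 i1 : I) (m : I -> M),
    i0 <> i1 -> (forall i, i = i0 \/ i = i1) -> csum I m = m i0 + m i1;
  csum_partition : forall (I J : Type) (p : I -> J) (m : I -> M),
    csum J (fun j => csum {i : I | p i = j} (fun i => m (sval i))) = csum I m
}.

#[short(type="completeMonoidType")]
HB.structure Definition CompleteMonoid :=
  {M of isCompleteMonoid M & GRing.Nmodule M}.

HB.mixin Record CompleteMonoid_isCompleteSemiRing S
    & CompleteMonoid S & GRing.PzSemiRing S := {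
  csum_mull : forall (I : Type) (s : S) (m : I -> S),
    csum I (fun i => s * m i) = s * csum I m;
  csum_mulr : forall (I : Type) (s : S) (m : I -> S),
    csum I (fun i => m i * s) = csum I m * s
}.

#[short(type="completeSemiRingType")]
HB.structure Definition CompleteSemiRing :=
  {S of CompleteMonoid_isCompleteSemiRing S & CompleteMonoid S
      & GRing.PzSemiRing S}.

Arguments csum {s I} _.
Arguments csum_empty {s I} m _.
Arguments csum_singleton {s I} i0 m _.
Arguments csum_pair {s I} i0 i1 m _ _.
Arguments csum_partition {s I J} p m.
Arguments csum_mull {s I} _ m.
Arguments csum_mulr {s I} _ m.

Section CompleteMonoidTheory.
Variable M : completeMonoidType.

Lemma eq_csum (I : Type) (m m' : I -> M) : m =1 m' -> csum m = csum m'.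
Proof. by move=> /funext ->. Qed.

Lemma csum_reindex (I J : Type) (h : I -> J) (g : J -> I) (m : J -> M) :
  cancel h g -> cancel g h -> csum (fun i => m (h i)) = csum m.
Proof.
move=> hK gK; rewrite -(csum_partition h); apply: eq_csum => j.
rewrite (csum_singleton (exist _ (g j) (gK j))) /= ?gK// => -[i hi].
by apply: eq_exist => /=; rewrite -hi hK.
Qed.

Lemma csum_bij (I J : Type) (h : I -> J) (m : J -> M) :
  injective h -> (forall j, exists i, h i = j) ->
  csum (fun i => m (h i)) = csum m.
Proof.
by move=> h_inj /choice[g gK]; apply: (csum_reindex (g := g)) => // i; apply: h_inj.
Qed.

Lemma csum_const0 (I : Type) : csum (fun _ : I => 0 : M) = 0.
Proof.
pose p (x : False) : I := match x with end.
rewrite -[RHS](csum_empty (fun x : False => match x with end : M) id).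
rewrite -(csum_partition p); apply: eq_csum => i.
by rewrite csum_empty// => -[[]].
Qed.

Lemma csum_single (I : Type) (i0 : I) (m : I -> M) :
  (forall i, i <> i0 -> m i = 0) -> csum m = m i0.
Proof.
move=> m0; rewrite -(csum_partition (fun i => `[< i = i0 >])).
rewrite (csum_pair true false)//; last by case; [left|right].
have h0 : `[< i0 = i0 >] = true by apply/asboolP.
rewrite (csum_singleton (exist _ i0 h0)); last first.
  by move=> [i hi]; apply: eq_exist => /=; apply/asboolP.
rewrite -[RHS]addr0; congr (_ + _); rewrite -[RHS](csum_const0 {i : I | `[< i = i0 >] = false}).
by apply: eq_csum => -[i /= hi]; apply: m0 => ie; rewrite asboolT in hi.
Qed.

Lemma csum_sig (I : Type) (J : I -> Type) (m : forall i, J i -> M) :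
  csum (fun i => csum (@m i)) = csum (fun x : {i & J i} => m (tag x) (tagged x)).
Proof.
pose h i (j : J i) : {x : {i & J i} | tag x = i} := exist _ (Tagged J j) erefl.
pose g i (x : {x : {i & J i} | tag x = i}) : J i :=
  eq_rect _ J (tagged (sval x)) _ (proj2_sig x).
have gK i : cancel (g i) (h i).
  by case=> -[i' j] /= e; subst i.
rewrite -[RHS](csum_partition (fun x : {i & J i} => tag x)).
apply: eq_csum => i /=.
by rewrite -(csum_reindex (h := h i) (g := g i) _ _ (gK i)).
Qed.

End CompleteMonoidTheory.

Lemma csum_add (M : completeMonoidType) (I : Type) (m m' : I -> M) :
  csum (fun i => m i + m' i) = csum m + csum m'.
Proof.
pose f (x : {_ : bool & I}) := if tag x then m (tagged x) else m' (tagged x).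
pose g (x : {_ : I & bool}) := if tagged x then m (tag x) else m' (tag x).
pose h (x : {_ : bool & I}) : {_ : I & bool} :=
  @Tagged I (tagged x) (fun=> bool) (tag x).
pose h' (x : {_ : I & bool}) : {_ : bool & I} :=
  @Tagged bool (tagged x) (fun=> I) (tag x).
have fg : csum f = csum g.
  rewrite -(csum_reindex (h := h) (g := h'))//; [by case|by case].
have /= := csum_sig (fun (b : bool) (i : I) => if b then m i else m' i).
rewrite -/f fg (csum_pair true false)//; last by case; [left|right].
move=> ->; have /= := csum_sig (fun (i : I) (b : bool) => if b then m i else m' i).
rewrite -/g => <-; apply: eq_csum => i.
by rewrite (csum_pair true false)//; case; [left|right].
Qed.

(* [comp g f _] is the composite g o f. *)
Record smallCategory := SmallCategory {
  obj : Type;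
  mor : Type;
  dom : mor -> obj;
  cod : mor -> obj;
  idm : obj -> mor;
  comp : forall g f : mor, cod f = dom g -> mor;
  dom_idm : forall x, dom (idm x) = x;
  cod_idm : forall x, cod (idm x) = x;
  dom_comp : forall g f (e : cod f = dom g), dom (comp e) = dom f;
  cod_comp : forall g f (e : cod f = dom g), cod (comp e) = cod g;
  comp_idl : forall f (e : cod f = dom (idm (cod f))), comp e = f;
  comp_idr : forall f (e : cod (idm (dom f)) = dom f), comp e = f;
  comp_assoc : forall h g f (e1 : cod f = dom g) (e2 : cod g = dom h)
    (e3 : cod (comp e1) = dom h) (e4 : cod f = dom (comp e2)),
    comp e3 = comp e4
}.

Arguments comp_assoc {s h g f} e1 e2 e3 e4.

Record strictMonoidalCategory := StrictMonoidalCategory {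
  smc_cat :> smallCategory;
  tensO : obj smc_cat -> obj smc_cat -> obj smc_cat;
  unitO : obj smc_cat;
  tensM : mor smc_cat -> mor smc_cat -> mor smc_cat;
  dom_tens : forall f g, dom (tensM f g) = tensO (dom f) (dom g);
  cod_tens : forall f g, cod (tensM f g) = tensO (cod f) (cod g);
  tens_idm : forall x y, tensM (idm x) (idm y) = idm (tensO x y);
  tens_comp : forall g f g' f' (e : cod f = dom g) (e' : cod f' = dom g')
    (e'' : cod (tensM f f') = dom (tensM g g')),
    tensM (comp e) (comp e') = comp e'';
  tensO_assoc : associative tensO;
  tensO_idl : left_id unitO tensO;
  tensO_idr : right_id unitO tensO;
  tensM_assoc : associative tensM;
  tensM_idl : left_id (idm unitO) tensM;
  tensM_idr : right_id (idm unitO) tensM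
}.

Definition Qfun (S : completeSemiRingType) (C : smallCategory) := mor C -> S.

Section QMonoid.
Variables (S : completeSemiRingType) (C : smallCategory).

HB.instance Definition _ := GRing.Nmodule.copy (Qfun S C) (mor C -> S).

Definition Qsum (I : Type) (m : I -> Qfun S C) : Qfun S C :=
  fun g => csum (fun i => m i g).

Fact Qsum_empty I (m : I -> Qfun S C) : (I -> False) -> Qsum m = 0.
Proof. by move=> I0; apply/funext => g; rewrite /Qsum csum_empty. Qed.

Fact Qsum_singleton I (i0 : I) (m : I -> Qfun S C) :
  (forall i, i = i0) -> Qsum m = m i0.
Proof. by move=> h; apply/funext => g; rewrite /Qsum (csum_singleton i0). Qed.

Fact Qsum_pair I (i0 i1 : I) (m : I -> Qfun S C) :
  i0 <> i1 -> (forall i, i = i0 \/ i = i1) -> Qsum m = m i0 + m i1.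
Proof. by move=> n h; apply/funext => g; rewrite /Qsum (csum_pair i0 i1). Qed.

Fact Qsum_partition I J (p : I -> J) (m : I -> Qfun S C) :
  Qsum (fun j => Qsum (fun i : {i : I | p i = j} => m (sval i))) = Qsum m.
Proof. by apply/funext => g; exact: (csum_partition p (fun i => m i g)). Qed.

HB.instance Definition _ := isCompleteMonoid.Build (Qfun S C)
  Qsum_empty Qsum_singleton Qsum_pair Qsum_partition.

End QMonoid.

(* [rel b a g] reads "b after a is g"; it is instantiated with composition and
   with the tensor product. *)
Section Convolution.
Variables (S : completeSemiRingType) (T : Type).
Variables (rel : T -> T -> T -> Prop) (idp : T -> Prop).

Definition conv (a b : T -> S) (g : T) : S :=
  csum (fun p : {p : T * T | rel p.1 p.2 g} => b (sval p).1 * a (sval p).2).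

Definition conv1 (g : T) : S := if `[< idp g >] then 1 else 0.

Hypothesis relA : forall x y z g,
  (exists2 u, rel y z u & rel x u g) <-> (exists2 v, rel x y v & rel v z g).
Hypothesis rel_fun : forall b a g g', rel b a g -> rel b a g' -> g = g'.
Hypothesis rel_idl : forall e a g, idp e -> rel e a g -> a = g.
Hypothesis rel_idr : forall b e g, idp e -> rel b e g -> b = g.
Hypothesis idl_ex : forall g, exists2 e, idp e & rel e g g.
Hypothesis idr_ex : forall g, exists2 e, idp e & rel g e g.
Hypothesis idl_uniq : forall g e e',
  idp e -> rel e g g -> idp e' -> rel e' g g -> e = e'.
Hypothesis idr_uniq : forall g e e',
  idp e -> rel g e g -> idp e' -> rel g e' g -> e = e'.

Fact conv_assoc a b c : conv a (conv b c) = conv (conv a b) c.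
Proof.
apply/funext => g; rewrite /conv.
pose P1 (t : T * T * T) := exists2 u, rel t.1.2 t.2 u & rel t.1.1 u g.
pose P2 (t : T * T * T) := exists2 v, rel t.1.1 t.1.2 v & rel v t.2 g.
have P12 : P1 = P2 by apply/funext => -[[x y] z]; apply/propext; exact: relA.
pose F (t : T * T * T) := c t.1.1 * b t.1.2 * a t.2.
transitivity (csum (fun t : {t | P2 t} => F (sval t))); last first.
  rewrite -P12.
  under [RHS]eq_csum do rewrite -csum_mull.
  rewrite csum_sig.
  pose h (x : {p : {p : T * T | rel p.1 p.2 g}
               & {q : T * T | rel q.1 q.2 (sval p).2}}) : {t | P1 t} :=
    exist P1 ((sval (tag x)).1, (sval (tagged x)).1, (sval (tagged x)).2)
      (ex_intro2 _ _ (sval (tag x)).2 (svalP (tagged x)) (svalP (tag x))).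
  have h_inj x y : h x = h y -> x = y.
    move: x y => [[[x u] /= xu] [[y z] /= yz]] [[[x' u'] /= xu'] [[y' z'] /= yz']].
    move=> /(congr1 sval)/= -[ex ey ez]; subst x' y' z'.
    have eu := rel_fun yz yz'; subst u'.
    by rewrite (Prop_irrelevance xu xu') (Prop_irrelevance yz yz').
  have h_surj t : exists x, h x = t.
    case: t => -[[x y] z] [/= u yz xu].
    pose p0 := exist (fun p : T * T => rel p.1 p.2 g) (x, u) xu.
    pose q0 : {q : T * T | rel q.1 q.2 (sval p0).2} := exist _ (y, z) yz.
    exists (existT _ p0 q0); exact: eq_exist.
  rewrite -(csum_bij (h := h) _ h_inj h_surj).
  by apply: eq_csum => x; rewrite /F /= mulrA.
under [LHS]eq_csum do rewrite -csum_mulr.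
rewrite csum_sig.
pose h (x : {p : {p : T * T | rel p.1 p.2 g}
             & {q : T * T | rel q.1 q.2 (sval p).1}}) : {t | P2 t} :=
  exist P2 ((sval (tagged x)).1, (sval (tagged x)).2, (sval (tag x)).2)
    (ex_intro2 _ _ (sval (tag x)).1 (svalP (tagged x)) (svalP (tag x))).
have h_inj x y : h x = h y -> x = y.
  move: x y => [[[v z] /= vz] [[x y] /= xy]] [[[v' z'] /= vz'] [[x' y'] /= xy']].
  move=> /(congr1 sval)/= -[ex ey ez]; subst x' y' z'.
  have eu := rel_fun xy xy'; subst v'.
  by rewrite (Prop_irrelevance vz vz') (Prop_irrelevance xy xy').
have h_surj t : exists x, h x = t.
  case: t => -[[x y] z] [/= v xy vz].
  pose p0 := exist (fun p : T * T => rel p.1 p.2 g) (v, z) vz.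
  pose q0 : {q : T * T | rel q.1 q.2 (sval p0).1} := exist _ (x, y) xy.
  exists (existT _ p0 q0); exact: eq_exist.
by rewrite -(csum_bij (h := h) _ h_inj h_surj).
Qed.

Fact conv_1l a : conv conv1 a = a.
Proof.
apply/funext => g; rewrite /conv.
have [e ide eg] := idr_ex g.
rewrite (csum_single (i0 := exist (fun p : T * T => rel p.1 p.2 g) (g, e) eg)).
  by rewrite /= /conv1 asboolT// mulr1.
move=> [[b e'] /= r] ne; rewrite /conv1.
have [ide'|] := pselect (idp e'); last by move=> ?; rewrite asboolF// mulr0.
exfalso; apply: ne; apply: eq_exist.
have eb := rel_idr ide' r; subst b.
by rewrite (idr_uniq ide eg ide' r).
Qed.

Fact conv_1r a : conv a conv1 = a.
Proof.
apply/funext => g; rewrite /conv.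
have [e ide eg] := idl_ex g.
rewrite (csum_single (i0 := exist (fun p : T * T => rel p.1 p.2 g) (e, g) eg)).
  by rewrite /= /conv1 asboolT// mul1r.
move=> [[e' b] /= r] ne; rewrite /conv1.
have [ide'|] := pselect (idp e'); last by move=> ?; rewrite asboolF// mul0r.
exfalso; apply: ne; apply: eq_exist.
have eb := rel_idl ide' r; subst b.
by rewrite (idl_uniq ide eg ide' r).
Qed.

Fact conv_Dl a b c g : conv (fun x => a x + b x) c g = conv a c g + conv b c g.
Proof. by rewrite -csum_add; apply: eq_csum => p; rewrite mulrDr. Qed.

Fact conv_Dr a b c g : conv a (fun x => b x + c x) g = conv a b g + conv a c g.
Proof. by rewrite -csum_add; apply: eq_csum => p; rewrite mulrDl. Qed.

Fact conv_0l a g : conv (fun=> 0) a g = 0.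
Proof. by rewrite -[RHS](csum_const0 S {p : T * T | rel p.1 p.2 g}); apply: eq_csum => p; rewrite mulr0. Qed.

Fact conv_0r a g : conv a (fun=> 0) g = 0.
Proof. by rewrite -[RHS](csum_const0 S {p : T * T | rel p.1 p.2 g}); apply: eq_csum => p; rewrite mul0r. Qed.

Fact conv_csuml I (a : T -> S) (m : I -> T -> S) g :
  csum (fun i => conv a (m i) g) = conv a (fun x => csum (fun i => m i x)) g.
Proof.
rewrite /conv; under [RHS]eq_csum do rewrite -csum_mulr.
rewrite !csum_sig.
pose h (x : {_ : I & {p : T * T | rel p.1 p.2 g}}) := 
  @Tagged _ (tagged x) (fun _ : {p : T * T | rel p.1 p.2 g} => I) (tag x).
pose h' (x : {_ : {p : T * T | rel p.1 p.2 g} & I}) :=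
  @Tagged _ (tagged x) (fun _ : I => {p : T * T | rel p.1 p.2 g}) (tag x).
by rewrite -(csum_reindex (h := h) (g := h')) //; case.
Qed.

Fact conv_csumr I (a : T -> S) (m : I -> T -> S) g :
  csum (fun i => conv (m i) a g) = conv (fun x => csum (fun i => m i x)) a g.
Proof.
rewrite /conv; under [RHS]eq_csum do rewrite -csum_mull.
rewrite !csum_sig.
pose h (x : {_ : I & {p : T * T | rel p.1 p.2 g}}) := 
  @Tagged _ (tagged x) (fun _ : {p : T * T | rel p.1 p.2 g} => I) (tag x).
pose h' (x : {_ : {p : T * T | rel p.1 p.2 g} & I}) :=
  @Tagged _ (tagged x) (fun _ : I => {p : T * T | rel p.1 p.2 g}) (tag x).
by rewrite -(csum_reindex (h := h) (g := h')) //; case.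
Qed.

End Convolution.

Section Qsemirings.
Variable S : completeSemiRingType.

Definition comp_rel (C : smallCategory) (beta alpha gamma : mor C) : Prop :=
  exists e : cod alpha = dom beta, comp e = gamma.

(* The factors of the tensor product are in the opposite order: a x b at gamma
   sums b(beta) * a(alpha) over gamma = alpha (x) beta. *)
Definition tens_rel (C : strictMonoidalCategory) (beta alpha gamma : mor C)
    : Prop :=
  tensM alpha beta = gamma.

Definition is_idm (C : smallCategory) (e : mor C) : Prop :=
  exists x, e = idm x.

Definition is_id_unit (C : strictMonoidalCategory) (e : mor C) : Prop :=
  e = idm (unitO C).

Definition Qcomp (C : smallCategory) := Qfun S C.
Definition Qtens (C : strictMonoidalCategory) := Qfun S C.

Section Comp.
Variable C : smallCategory.
Local Notation rel := (@comp_rel C).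
Local Notation idp := (@is_idm C).

Lemma comp_relA (x y z g : mor C) :
  (exists2 u, rel y z u & rel x u g) <-> (exists2 v, rel x y v & rel v z g).
Proof.
split=> [[_ [e1 <-] [e2 <-]]|[_ [e1 <-] [e2 <-]]].
- have e3 : cod y = dom x by rewrite -e2 cod_comp.
  have e4 : cod z = dom (comp e3) by rewrite dom_comp.
  by exists (comp e3); [exists e3|exists e4; rewrite (comp_assoc e1 e3 e2 e4)].
- have e3 : cod z = dom y by rewrite e2 dom_comp.
  have e4 : cod (comp e3) = dom x by rewrite cod_comp.
  by exists (comp e3); [exists e3|exists e4; rewrite (comp_assoc e3 e1 e4 e2)].
Qed.

Lemma comp_rel_fun (b a g g' : mor C) : rel b a g -> rel b a g' -> g = g'.
Proof. by move=> [e <-] [e' <-]; rewrite (Prop_irrelevance e e'). Qed.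

Lemma comp_rel_idl (e a g : mor C) : idp e -> rel e a g -> a = g.
Proof.
move=> [x ->] [h <-]; have := h; rewrite dom_idm => hx; subst x.
by rewrite comp_idl.
Qed.

Lemma comp_rel_idr (b e g : mor C) : idp e -> rel b e g -> b = g.
Proof.
move=> [x ->] [h <-]; have := h; rewrite cod_idm => hx; subst x.
by rewrite comp_idr.
Qed.

Lemma comp_idl_ex (g : mor C) : exists2 e, idp e & rel e g g.
Proof.
exists (idm (cod g)); first by exists (cod g).
have h : cod g = dom (idm (cod g)) by rewrite dom_idm.
by exists h; rewrite comp_idl.
Qed.

Lemma comp_idr_ex (g : mor C) : exists2 e, idp e & rel g e g.
Proof.
exists (idm (dom g)); first by exists (dom g).
have h : cod (idm (dom g)) = dom g by rewrite cod_idm.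
by exists h; rewrite comp_idr.
Qed.

Lemma comp_idl_uniq (g e e' : mor C) :
  idp e -> rel e g g -> idp e' -> rel e' g g -> e = e'.
Proof.
by move=> [x ->] [+ _] [y ->] [+ _]; rewrite !dom_idm => -> ->.
Qed.

Lemma comp_idr_uniq (g e e' : mor C) :
  idp e -> rel g e g -> idp e' -> rel g e' g -> e = e'.
Proof.
by move=> [x ->] [+ _] [y ->] [+ _]; rewrite !cod_idm => -> ->.
Qed.

HB.instance Definition _ := CompleteMonoid.copy (Qcomp C) (Qfun S C).

Let mul (a b : Qcomp C) : Qcomp C := conv rel a b.
Let one : Qcomp C := conv1 S idp.

Fact Qcomp_mulA : associative mul.
Proof. move=> a b c; exact: (conv_assoc comp_relA comp_rel_fun). Qed.
Fact Qcomp_mul1 : left_id one mul.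
Proof. by move=> a; apply: (conv_1l comp_rel_idr comp_idr_ex comp_idr_uniq). Qed.
Fact Qcomp_1mul : right_id one mul.
Proof. by move=> a; apply: (conv_1r comp_rel_idl comp_idl_ex comp_idl_uniq). Qed.
Fact Qcomp_mulDl : left_distributive mul +%R.
Proof. by move=> a b c; apply/funext => g; apply: conv_Dl. Qed.
Fact Qcomp_mulDr : right_distributive mul +%R.
Proof. by move=> a b c; apply/funext => g; apply: conv_Dr. Qed.
Fact Qcomp_mul0 : left_zero 0 mul.
Proof. by move=> a; apply/funext => g; apply: conv_0l. Qed.
Fact Qcomp_0mul : right_zero 0 mul.
Proof. by move=> a; apply/funext => g; apply: conv_0r. Qed.

HB.instance Definition _ := GRing.Nmodule_isPzSemiRing.Build (Qcomp C)
  Qcomp_mulA Qcomp_mul1 Qcomp_1mul Qcomp_mulDl Qcomp_mulDr Qcomp_mul0 Qcomp_0mul.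

Fact Qcomp_csum_mull (I : Type) (s : Qcomp C) (m : I -> Qcomp C) :
  csum (fun i => s * m i) = s * csum m.
Proof. by apply/funext => g; apply: conv_csuml. Qed.
Fact Qcomp_csum_mulr (I : Type) (s : Qcomp C) (m : I -> Qcomp C) :
  csum (fun i => m i * s) = csum m * s.
Proof. by apply/funext => g; apply: conv_csumr. Qed.

HB.instance Definition _ := CompleteMonoid_isCompleteSemiRing.Build (Qcomp C)
  Qcomp_csum_mull Qcomp_csum_mulr.

End Comp.

Section Tens.
Variable C : strictMonoidalCategory.
Local Notation rel := (@tens_rel C).
Local Notation idp := (@is_id_unit C).

Lemma tens_relA (x y z g : mor C) :
  (exists2 u, rel y z u & rel x u g) <-> (exists2 v, rel x y v & rel v z g).
Proof.
rewrite /tens_rel; split=> [[_ <- <-]|[_ <- <-]].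
- by exists (tensM y x); rewrite ?tensM_assoc.
- by exists (tensM z y); rewrite ?tensM_assoc.
Qed.

Lemma tens_rel_fun (b a g g' : mor C) : rel b a g -> rel b a g' -> g = g'.
Proof. by rewrite /tens_rel => <- <-. Qed.

Lemma tens_rel_idl (e a g : mor C) : idp e -> rel e a g -> a = g.
Proof. by rewrite /tens_rel => ->; rewrite tensM_idr. Qed.

Lemma tens_rel_idr (b e g : mor C) : idp e -> rel b e g -> b = g.
Proof. by rewrite /tens_rel => ->; rewrite tensM_idl. Qed.

Lemma tens_idl_ex (g : mor C) : exists2 e, idp e & rel e g g.
Proof. by exists (idm (unitO C)) => //; exact: tensM_idr. Qed.

Lemma tens_idr_ex (g : mor C) : exists2 e, idp e & rel g e g.
Proof. by exists (idm (unitO C)) => //; exact: tensM_idl. Qed.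

Lemma tens_idl_uniq (g e e' : mor C) :
  idp e -> rel e g g -> idp e' -> rel e' g g -> e = e'.
Proof. by move=> -> _ -> _. Qed.

Lemma tens_idr_uniq (g e e' : mor C) :
  idp e -> rel g e g -> idp e' -> rel g e' g -> e = e'.
Proof. by move=> -> _ -> _. Qed.

HB.instance Definition _ := CompleteMonoid.copy (Qtens C) (Qfun S C).

Let mul (a b : Qtens C) : Qtens C := conv rel a b.
Let one : Qtens C := conv1 S idp.

Fact Qtens_mulA : associative mul.
Proof. move=> a b c; exact: (conv_assoc tens_relA tens_rel_fun). Qed.
Fact Qtens_mul1 : left_id one mul.
Proof. by move=> a; apply: (conv_1l tens_rel_idr tens_idr_ex tens_idr_uniq). Qed.
Fact Qtens_1mul : right_id one mul.
Proof. by move=> a; apply: (conv_1r tens_rel_idl tens_idl_ex tens_idl_uniq). Qed.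
Fact Qtens_mulDl : left_distributive mul +%R.
Proof. by move=> a b c; apply/funext => g; apply: conv_Dl. Qed.
Fact Qtens_mulDr : right_distributive mul +%R.
Proof. by move=> a b c; apply/funext => g; apply: conv_Dr. Qed.
Fact Qtens_mul0 : left_zero 0 mul.
Proof. by move=> a; apply/funext => g; apply: conv_0l. Qed.
Fact Qtens_0mul : right_zero 0 mul.
Proof. by move=> a; apply/funext => g; apply: conv_0r. Qed.

HB.instance Definition _ := GRing.Nmodule_isPzSemiRing.Build (Qtens C)
  Qtens_mulA Qtens_mul1 Qtens_1mul Qtens_mulDl Qtens_mulDr Qtens_mul0 Qtens_0mul.

Fact Qtens_csum_mull (I : Type) (s : Qtens C) (m : I -> Qtens C) :
  csum (fun i => s * m i) = s * csum m.
Proof. by apply/funext => g; apply: conv_csuml. Qed.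
Fact Qtens_csum_mulr (I : Type) (s : Qtens C) (m : I -> Qtens C) :
  csum (fun i => m i * s) = csum m * s.
Proof. by apply/funext => g; apply: conv_csumr. Qed.

HB.instance Definition _ := CompleteMonoid_isCompleteSemiRing.Build (Qtens C)
  Qtens_csum_mull Qtens_csum_mulr.

End Tens.
End Qsemirings.

Section Frobenius.
Variable R : pzSemiRingType.

Record bisemimodule (M : nmodType) (la : R -> M -> M) (ra : M -> R -> M)
    : Prop := Bisemimodule {
  laDr : forall r x y, la r (x + y) = la r x + la r y;
  laDl : forall r s x, la (r + s) x = la r x + la s x;
  laA : forall r s x, la (r * s) x = la r (la s x);
  la1 : forall x, la 1 x = x;
  la0r : forall x, la 0 x = 0;
  lar0 : forall r, la r 0 = 0;
  raDl : forall r x y, ra (x + y) r = ra x r + ra y r;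
  raDr : forall r s x, ra x (r + s) = ra x r + ra x s;
  raA : forall r s x, ra x (r * s) = ra (ra x r) s;
  ra1 : forall x, ra x 1 = x;
  rar0 : forall x, ra x 0 = 0;
  ra0r : forall r, ra 0 r = 0;
  la_ra : forall r s x, ra (la r x) s = la r (ra x s)
}.

Record two_sided_semialgebra (A : pzSemiRingType)
    (la : R -> A -> A) (ra : A -> R -> A) : Prop := TwoSidedSemialgebra {
  semialgebra_bisemimodule : bisemimodule la ra;
  la_mul : forall r a b, la r (a * b) = la r a * b;
  mul_ra : forall r a b, ra (a * b) r = a * ra b r
}.

Record bisemimodule_hom (M N : nmodType) (laM : R -> M -> M) (raM : M -> R -> M)
    (laN : R -> N -> N) (raN : N -> R -> N) (f : M -> N) : Prop :=
  BisemimoduleHom {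
  bhom0 : f 0 = 0;
  bhomD : forall x y, f (x + y) = f x + f y;
  bhom_la : forall r x, f (laM r x) = laN r (f x);
  bhom_ra : forall r x, f (raM x r) = raN (f x) r
}.

Record frobenius_semialgebra (A : pzSemiRingType)
    (la : R -> A -> A) (ra : A -> R -> A) (eps : A -> R) : Prop :=
  FrobeniusSemialgebra {
  frobenius_semialgebra_alg : two_sided_semialgebra la ra;
  frobenius_counit :
    bisemimodule_hom la ra (@GRing.mul R) (@GRing.mul R) eps;
  frobenius_nondegl :
    forall a : A, a <> 0 -> exists b : A, eps (a * b) <> 0;
  frobenius_nondegr :
    forall b : A, b <> 0 -> exists a : A, eps (a * b) <> 0
}.

End Frobenius.

Record homeo (T U : topologicalType) := Homeo {
  homeo_fun :> T -> U;
  homeo_inv : U -> T;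
  homeo_funK : cancel homeo_fun homeo_inv;
  homeo_invK : cancel homeo_inv homeo_fun;
  homeo_cont : continuous homeo_fun;
  homeo_inv_cont : continuous homeo_inv
}.

Section Manifolds.
Variables (R : realType) (k : nat).

(* {x_0 >= 0}, and all of R^0 when k = 0 *)
Definition halfspace : set 'rV[R]_k :=
  [set x | forall i : 'I_k, i = 0%N :> nat -> 0 <= x 0 i].

Definition chart_at (T : topologicalType) (H : set 'rV[R]_k) (p : T) : Prop :=
  exists (U : set T) (V : set 'rV[R]_k),
    [/\ open U, U p, open V
      & inhabited (homeo (set_type U) (set_type (V `&` H)))].

Definition manifold (T : topologicalType) : Prop :=
  [/\ hausdorff_space T, @second_countable T
    & forall p : T, chart_at halfspace p].

Definition manifold_boundary (T : topologicalType) : set T :=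
  [set p : T | ~ chart_at setT p].
Arguments manifold_boundary : clear implicits.

Definition compact_manifold (T : topologicalType) : Prop :=
  manifold T /\ compact [set: T].

Definition closed_manifold (T : topologicalType) : Prop :=
  compact_manifold T /\ manifold_boundary T = set0.

Definition isotopic_to_id (T : topologicalType) (phi : homeo T T) : Prop :=
  exists H : R * T -> T,
    [/\ {within [set p : R * T | 0 <= p.1 <= 1], continuous H},
        forall t : R, 0 <= t <= 1 ->
          exists h : homeo T T, forall x, h x = H (t, x),
        forall x, H (0, x) = x
      & forall x, H (1, x) = phi x].

End Manifolds.
Arguments manifold_boundary R k T : clear implicits.

(* Manifolds are given as subsets of a topological space X, with the subspace
   topology (any space is the full subset of itself).  In this way a submanifold
   of W lives in the same X as W, "W_0 is contained in W" is an inclusion of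
   sets, and restrictions in stages compose on the nose. *)
Section Bordisms.
Variables (R : realType) (n : nat).

Record closedMfd (X : topologicalType) := ClosedMfd {
  mpts :> set X;
  mpts_closed : closed_manifold R n (set_type mpts)
}.

Record bordism (X : topologicalType) := Bordism {
  body : set X;
  bin : closedMfd X;
  bout : closedMfd X;
  body_mfd : compact_manifold R n.+1 (set_type body);
  body_boundary :
    set_val @` manifold_boundary R n.+1 (set_type body) = bin `|` bout;
  bin_bout : bin `&` bout = set0
}.

Definition bd (X : topologicalType) (W : bordism X) : set X :=
  set_val @` manifold_boundary R n.+1 (set_type (body W)).

(* Being a compact (n+1)-manifold in the subspace topology, [body W0] is a
   codimension 0 submanifold as soon as it is contained in [body W]. *)
Definition subbordism (X : topologicalType) (W0 W : bordism X) : Prop :=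
  [/\ body W0 `<=` body W,
      forall x, mpts (bin W0) x ->
        connected_component (bin W0) x `&` bd W = set0 \/
        connected_component (bin W0) x `<=` bin W
    & forall x, mpts (bout W0) x ->
        connected_component (bout W0) x `&` bd W = set0 \/
        connected_component (bout W0) x `<=` bout W].

(* The disjoint union of bordisms in X and in Y is realized inside X + Y; the two
   summands are compact, hence clopen in the Hausdorff space [body W]. *)
Definition is_disjoint_union (X : topologicalType) (W W1 W2 : bordism X) : Prop :=
  [/\ body W = body W1 `|` body W2, body W1 `&` body W2 = set0,
      bin W = bin W1 `|` bin W2 :> set X
    & bout W = bout W1 `|` bout W2 :> set X].

(* Since W1 and W2 are compact and W is Hausdorff, W carries the quotient topology
   of the pushout of W1 and W2 along N. *)
Definition is_gluing (X : topologicalType) (W W1 W2 : bordism X)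
    (N : closedMfd X) : Prop :=
  [/\ [/\ body W = body W1 `|` body W2 & body W1 `&` body W2 = N],
      [/\ bout W1 = N :> set X & bin W2 = N :> set X],
      bin W = bin W1 :> set X & bout W = bout W2 :> set X].

Record bordHomeo (X Y : topologicalType) (W : bordism X) (W' : bordism Y) :=
  BordHomeo {
  bhomeo :> homeo (set_type (body W)) (set_type (body W'));
  bhomeo_in : forall p, mpts (bin W) (set_val p) <-> mpts (bin W') (set_val (bhomeo p));
  bhomeo_out : forall p, mpts (bout W) (set_val p) <-> mpts (bout W') (set_val (bhomeo p))
}.

Definition mfdHomeo (X Y : topologicalType) (M : closedMfd X) (M' : closedMfd Y) :=
  homeo (set_type M) (set_type M').

Definition restricts (X Y : topologicalType) (A0 A : set X) (B0 B : set Y)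
    (phi0 : A0 -> B0) (phi : A -> B) : Prop :=
  forall (p : A0) (q : A),
    set_val p = set_val q -> set_val (phi0 p) = set_val (phi q).

Lemma body_bd (X : topologicalType) (W : bordism X) : bd W `<=` body W.
Proof. by move=> _ [p _ <-]; exact: set_mem (valP p). Qed.

Lemma bin_body (X : topologicalType) (W : bordism X) : bin W `<=` body W.
Proof. by move=> x Wx; apply: body_bd; rewrite /bd body_boundary; left. Qed.

Lemma bout_body (X : topologicalType) (W : bordism X) : bout W `<=` body W.
Proof. by move=> x Wx; apply: body_bd; rewrite /bd body_boundary; right. Qed.

Lemma bin_bout_disj (X : topologicalType) (W : bordism X) (x : X) :
  mpts (bin W) x -> mpts (bout W) x -> False.
Proof.
by move=> Ix Ox; have : (bin W `&` bout W) x by []; rewrite bin_bout.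
Qed.

Lemma connected_component_subset (X : topologicalType) (A : set X) (x : X) :
  connected_component A x `<=` A.
Proof. by move=> y [C [_ CA _]] /CA. Qed.

Lemma disjoint_union_sub1 (X : topologicalType) (W W1 W2 : bordism X) :
  is_disjoint_union W W1 W2 -> subbordism W1 W.
Proof.
move=> [eW _ eI eO]; split; first by rewrite eW => x; left.
- by move=> x _; right; rewrite eI => y /connected_component_subset; left.
- by move=> x _; right; rewrite eO => y /connected_component_subset; left.
Qed.

Lemma disjoint_union_sub2 (X : topologicalType) (W W1 W2 : bordism X) :
  is_disjoint_union W W1 W2 -> subbordism W2 W.
Proof.
move=> [eW _ eI eO]; split; first by rewrite eW => x; right.
- by move=> x _; right; rewrite eI => y /connected_component_subset; right.
- by move=> x _; right; rewrite eO => y /connected_component_subset; right.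
Qed.

Lemma gluing_sub1 (X : topologicalType) (W W1 W2 : bordism X) (N : closedMfd X) :
  is_gluing W W1 W2 N -> subbordism W1 W.
Proof.
move=> [[eW _] [eN1 eN2] eI eO]; split; first by rewrite eW => x; left.
- by move=> x _; right; rewrite eI => y /connected_component_subset.
- move=> x _; left; rewrite -subset0 => y [/connected_component_subset Ny].
  rewrite /bd body_boundary eI eO => -[Iy|Oy].
    exact: bin_bout_disj Iy Ny.
  by apply: (@bin_bout_disj _ W2 y) => //; rewrite eN2 -eN1.
Qed.

Lemma gluing_sub2 (X : topologicalType) (W W1 W2 : bordism X) (N : closedMfd X) :
  is_gluing W W1 W2 N -> subbordism W2 W.
Proof.
move=> [[eW _] [eN1 eN2] eI eO]; split; first by rewrite eW => x; right.
- move=> x _; left; rewrite -subset0 => y [/connected_component_subset Ny].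
  rewrite /bd body_boundary eI eO => -[Iy|Oy].
    by apply: (@bin_bout_disj _ W1 y) => //; rewrite eN1 -eN2.
  exact: bin_bout_disj Ny Oy.
- by move=> x _; right; rewrite eO => y /connected_component_subset.
Qed.

Lemma gluing_N1 (X : topologicalType) (W W1 W2 : bordism X) (N : closedMfd X) :
  is_gluing W W1 W2 N -> N `<=` body W1.
Proof. by move=> [_ [<- _] _ _]; exact: bout_body. Qed.

Lemma gluing_N2 (X : topologicalType) (W W1 W2 : bordism X) (N : closedMfd X) :
  is_gluing W W1 W2 N -> N `<=` body W2.
Proof. by move=> [_ [_ <-] _ _]; exact: bin_body. Qed.

End Bordisms.

Definition one_element (T : Type) : Prop := exists x : T, forall y, y = x.

(* Homeomorphisms enter the functoriality axioms through their graphs: "id" is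
   any homeomorphism equal to the identity, "psi o phi" any one equal to the
   composite. *)
Record fieldSystem (R : realType) (n : nat) := FieldSystem {
  FB : forall X : topologicalType, bordism R n X -> Type;
  FM : forall X : topologicalType, closedMfd R n X -> Type;
  FB_empty : forall X (W : bordism R n X), body W = set0 -> one_element (FB W);
  FM_empty : forall X (M : closedMfd R n X),
    M = set0 :> set X -> one_element (FM M);

  resBB : forall X (W W0 : bordism R n X), subbordism W0 W -> FB W -> FB W0;
  resMM : forall X (M M0 : closedMfd R n X), M0 `<=` M -> FM M -> FM M0;
  resBM : forall X (W : bordism R n X) (M : closedMfd R n X),
    M `<=` body W -> FB W -> FM M;
  resBBB : forall X (W W0 W1 : bordism R n X) (h0 : subbordism W0 W)
    (h1 : subbordism W1 W0) (h : subbordism W1 W) (f : FB W),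
    resBB h1 (resBB h0 f) = resBB h f;
  resBBM : forall X (W W0 : bordism R n X) (M : closedMfd R n X)
    (h0 : subbordism W0 W) (h1 : M `<=` body W0) (h : M `<=` body W)
    (f : FB W),
    resBM h1 (resBB h0 f) = resBM h f;
  resBMM : forall X (W : bordism R n X) (M M0 : closedMfd R n X)
    (h0 : M `<=` body W) (h1 : M0 `<=` M) (h : M0 `<=` body W) (f : FB W),
    resMM h1 (resBM h0 f) = resBM h f;
  resMMM : forall X (M M0 M1 : closedMfd R n X)
    (h0 : M0 `<=` M) (h1 : M1 `<=` M0) (h : M1 `<=` M) (f : FM M),
    resMM h1 (resMM h0 f) = resMM h f;

  pullB : forall X Y (W : bordism R n X) (W' : bordism R n Y),
    bordHomeo W W' -> FB W' -> FB W;
  pullM : forall X Y (M : closedMfd R n X) (M' : closedMfd R n Y),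
    mfdHomeo M M' -> FM M' -> FM M;
  pullB_bij : forall X Y (W : bordism R n X) (W' : bordism R n Y)
    (phi : bordHomeo W W'), bijective (pullB phi);
  pullM_bij : forall X Y (M : closedMfd R n X) (M' : closedMfd R n Y)
    (phi : mfdHomeo M M'), bijective (pullM phi);
  pullB_id : forall X (W : bordism R n X) (phi : bordHomeo W W),
    (forall p, phi p = p) -> forall f, pullB phi f = f;
  pullM_id : forall X (M : closedMfd R n X) (phi : mfdHomeo M M),
    (forall p, phi p = p) -> forall f, pullM phi f = f;
  pullB_comp : forall X Y V (W : bordism R n X) (W' : bordism R n Y)
    (W'' : bordism R n V) (phi : bordHomeo W W') (psi : bordHomeo W' W'')
    (chi : bordHomeo W W''),
    (forall p, chi p = psi (phi p)) ->
    forall f, pullB chi f = pullB phi (pullB psi f);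
  pullM_comp : forall X Y V (M : closedMfd R n X) (M' : closedMfd R n Y)
    (M'' : closedMfd R n V) (phi : mfdHomeo M M') (psi : mfdHomeo M' M'')
    (chi : mfdHomeo M M''),
    (forall p, chi p = psi (phi p)) ->
    forall f, pullM chi f = pullM phi (pullM psi f);
  pullB_resBB : forall X Y (W W0 : bordism R n X) (W' W0' : bordism R n Y)
    (h : subbordism W0 W) (h' : subbordism W0' W')
    (phi : bordHomeo W W') (phi0 : bordHomeo W0 W0'),
    restricts phi0 phi ->
    forall f, pullB phi0 (resBB h' f) = resBB h (pullB phi f);
  pullM_resMM : forall X Y (M M0 : closedMfd R n X) (M' M0' : closedMfd R n Y)
    (h : M0 `<=` M) (h' : M0' `<=` M')
    (phi : mfdHomeo M M') (phi0 : mfdHomeo M0 M0'),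
    restricts phi0 phi ->
    forall f, pullM phi0 (resMM h' f) = resMM h (pullM phi f);
  pullM_resBM : forall X Y (W : bordism R n X) (M : closedMfd R n X)
    (W' : bordism R n Y) (M' : closedMfd R n Y)
    (h : M `<=` body W) (h' : M' `<=` body W')
    (phi : bordHomeo W W') (phi0 : mfdHomeo M M'),
    restricts phi0 phi ->
    forall f, pullM phi0 (resBM h' f) = resBM h (pullB phi f);

  FB_disj : forall X (W W1 W2 : bordism R n X) (h : is_disjoint_union W W1 W2)
    (f1 : FB W1) (f2 : FB W2),
    exists! f : FB W,
      resBB (disjoint_union_sub1 h) f = f1 /\
      resBB (disjoint_union_sub2 h) f = f2;
  FM_disj : forall X (M M1 M2 : closedMfd R n X)
    (h1 : M1 `<=` M) (h2 : M2 `<=` M),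
    M = M1 `|` M2 :> set X -> M1 `&` M2 = set0 ->
    forall (f1 : FM M1) (f2 : FM M2),
    exists! f : FM M, resMM h1 f = f1 /\ resMM h2 f = f2;

  FB_glue : forall X (W W1 W2 : bordism R n X) (N : closedMfd R n X)
    (h : is_gluing W W1 W2 N) (f1 : FB W1) (f2 : FB W2),
    resBM (gluing_N1 h) f1 = resBM (gluing_N2 h) f2 ->
    exists! f : FB W,
      resBB (gluing_sub1 h) f = f1 /\ resBB (gluing_sub2 h) f = f2
}.

Section StateModule.
Variables (R : realType) (n : nat) (F : fieldSystem R n).
Variables (X : topologicalType) (M : closedMfd R n X).

Record state (Q : Type) := State {
  state_fun :> FM F M -> Q;
  state_inv : forall phi : mfdHomeo M M, isotopic_to_id R phi ->
    forall f, state_fun (pullM phi f) = state_fun f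
}.

HB.instance Definition _ (Q : Type) := gen_eqMixin (state Q).
HB.instance Definition _ (Q : Type) := gen_choiceMixin (state Q).

Lemma state_ext (Q : Type) (z w : state Q) : z =1 w -> z = w.
Proof.
case: z w => [z zP] [w wP] /= /funext zw; subst w.
by rewrite (Prop_irrelevance zP wP).
Qed.

Section StateSemiring.
Variable Q : pzSemiRingType.
Implicit Types z w : state Q.

Definition state_const (q : Q) : state Q := @State Q (fun=> q) (fun _ _ _ => erefl).

Fact state_map2_inv (op : Q -> Q -> Q) z w (phi : mfdHomeo M M) :
  isotopic_to_id R phi ->
  forall f, op (z (pullM phi f)) (w (pullM phi f)) = op (z f) (w f).
Proof. by move=> h f; rewrite (state_inv z h) (state_inv w h). Qed.

Definition state_map2 (op : Q -> Q -> Q) z w : state Q :=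
  State (@state_map2_inv op z w).

Fact state_map_inv (op : Q -> Q) z (phi : mfdHomeo M M) :
  isotopic_to_id R phi -> forall f, op (z (pullM phi f)) = op (z f).
Proof. by move=> h f; rewrite (state_inv z h). Qed.

Definition state_map (op : Q -> Q) z : state Q :=
  State (@state_map_inv op z).

Let add := state_map2 +%R.
Let mul := state_map2 *%R.
Let zero := state_const 0.
Let one := state_const 1.

Fact state_addA : associative add.
Proof. by move=> x y z; apply: state_ext => f /=; rewrite addrA. Qed.
Fact state_addC : commutative add.
Proof. by move=> x y; apply: state_ext => f /=; rewrite addrC. Qed.
Fact state_add0 : left_id zero add.
Proof. by move=> x; apply: state_ext => f /=; rewrite add0r. Qed.
Fact state_mulA : associative mul.
Proof. by move=> x y z; apply: state_ext => f /=; rewrite mulrA. Qed.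
Fact state_mul1l : left_id one mul.
Proof. by move=> x; apply: state_ext => f /=; rewrite mul1r. Qed.
Fact state_mul1r : right_id one mul.
Proof. by move=> x; apply: state_ext => f /=; rewrite mulr1. Qed.
Fact state_mulDl : left_distributive mul add.
Proof. by move=> x y z; apply: state_ext => f /=; rewrite mulrDl. Qed.
Fact state_mulDr : right_distributive mul add.
Proof. by move=> x y z; apply: state_ext => f /=; rewrite mulrDr. Qed.
Fact state_mul0l : left_zero zero mul.
Proof. by move=> x; apply: state_ext => f /=; rewrite mul0r. Qed.
Fact state_mul0r : right_zero zero mul.
Proof. by move=> x; apply: state_ext => f /=; rewrite mulr0. Qed.

HB.instance Definition _ := GRing.isPzSemiRing.Build (state Q)
  state_addA state_addC state_add0 state_mulA state_mul1l state_mul1r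
  state_mulDl state_mulDr state_mul0l state_mul0r.

Definition state_scalel (q : Q) (z : state Q) : state Q :=
  state_map (fun x => q * x) z.

Definition state_scaler (z : state Q) (q : Q) : state Q :=
  state_map (fun x => x * q) z.

End StateSemiring.

Definition counit (Q : completeSemiRingType) (z : state Q) : Q :=
  csum (fun f : FM F M => z f).

End StateModule.

Arguments state {R n} F {X} M Q.
Arguments state_scalel {R n} F {X} M {Q}.
Arguments state_scaler {R n} F {X} M {Q}.
Arguments counit {R n} F {X} M {Q}.

(* Main.v *)
Require Import Defs.
From mathcomp Require Import all_boot all_order all_algebra.
From mathcomp Require Import all_classical all_reals topology.

(** The semialgebra identities hold pointwise in the field variable, and the
    counit is a bisemimodule homomorphism because summation commutes with
    addition and with multiplication by a constant on either side.
    The content is nondegeneracy,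
    and there the unit state is always a witness: a complete monoid has no
    nontrivial way of writing 0 as a sum ([csum_eq0], an Eilenberg swindle), so a
    nonzero state [a] has [counit (a * 1) = counit a <> 0], and the same with
    [1 * a].  These arguments take place over an arbitrary complete semiring
    ([state_frobenius_semialgebra]), which covers both products on [Q] at once. *)

Set Implicit Arguments.
Unset Strict Implicit.
Unset Printing Implicit Defensive.
Import GRing.Theory.
Local Open Scope ring_scope.

Section CompleteMonoidZeroSums.
Variable M : completeMonoidType.

Lemma csum_split (I : Type) (i0 : I) (m : I -> M) :
  csum m = m i0 + csum (fun i : {i | i <> i0} => m (sval i)).
Proof.
rewrite -(csum_partition (fun i => `[< i = i0 >])).
rewrite (csum_pair true false) //; last by case; [left|right].
have i0_true : `[< i0 = i0 >] = true by apply/asboolP.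
congr (_ + _).
  rewrite (csum_singleton (exist _ i0 i0_true)) // => -[i hi].
  by apply: eq_exist; apply/asboolP.
pose h (x : {i | `[< i = i0 >] = false}) : {i | i <> i0} :=
  exist _ (sval x) (elimF (asboolP _) (svalP x)).
rewrite -(csum_bij (h := h)) // => [[x hx] [y hy] /(congr1 sval) /= xy|[i ni]].
  exact: eq_exist.
by exists (exist _ i (introF (asboolP _) ni)); exact: eq_exist.
Qed.

Lemma csum_nat_recl (m : nat -> M) : csum m = m 0%N + csum (fun k => m k.+1).
Proof.
rewrite (csum_split 0%N); congr (_ + _).
pose h k : {i | i <> 0%N} := exist _ k.+1 (nesym (O_S k)).
rewrite -(csum_bij (h := h)) // => [x y /(congr1 sval) []//|[[|k] k0] //].
by exists k; exact: eq_exist.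
Qed.

(** With [s] and [t] the sums of countably many copies of [x] and [y],
    [s + t = 0] is a sum of zeros, while [x + s = s]; hence
    [x = x + (s + t) = s + t = 0]. *)
Lemma complete_addr_eq0l (x y : M) : x + y = 0 -> x = 0.
Proof.
move=> xy0; pose s := csum (fun _ : nat => x); pose t := csum (fun _ : nat => y).
have st0 : s + t = 0.
  by rewrite /s /t -csum_add; under eq_csum do rewrite xy0; exact: csum_const0.
by rewrite -[x]addr0 -st0 addrA -[x + s]csum_nat_recl.
Qed.

Lemma csum_eq0 (I : Type) (m : I -> M) : csum m = 0 -> forall i, m i = 0.
Proof. by move=> + i; rewrite (csum_split i); exact: complete_addr_eq0l. Qed.

End CompleteMonoidZeroSums.

Section StateModuleFrobenius.
Variables (R : realType) (n : nat) (F : fieldSystem R n).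
Variables (X : topologicalType) (M : closedMfd R n X) (Q : completeSemiRingType).

Lemma state_bisemimodule :
  bisemimodule (M := state F M Q) (state_scalel F M) (state_scaler F M).
Proof.
split=> *; apply: state_ext => f /=.
- exact: mulrDr.
- exact: mulrDl.
- by rewrite mulrA.
- exact: mul1r.
- exact: mul0r.
- exact: mulr0.
- exact: mulrDl.
- exact: mulrDr.
- exact: mulrA.
- exact: mulr1.
- exact: mulr0.
- exact: mul0r.
- by rewrite mulrA.
Qed.

Lemma state_two_sided_semialgebra :
  two_sided_semialgebra (A := state F M Q) (state_scalel F M) (state_scaler F M).
Proof.
split; first exact: state_bisemimodule.
  by move=> q a b; apply: state_ext => f /=; exact: mulrA.
by move=> q a b; apply: state_ext => f /=; rewrite mulrA.
Qed.

Lemma counit_hom :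
  bisemimodule_hom (M := state F M Q) (state_scalel F M) (state_scaler F M)
    (@GRing.mul Q) (@GRing.mul Q) (counit F M).
Proof.
split.
- exact: csum_const0.
- by move=> a b; exact: csum_add.
- by move=> q a; exact: csum_mull.
- by move=> q a; exact: csum_mulr.
Qed.

Lemma counit_eq0 (a : state F M Q) : counit F M a = 0 -> a = 0.
Proof. by move=> a0; apply: state_ext => f; exact: csum_eq0 a0 f. Qed.

Lemma state_frobenius_semialgebra :
  frobenius_semialgebra (A := state F M Q)
    (state_scalel F M) (state_scaler F M) (counit F M).
Proof.
split; [exact: state_two_sided_semialgebra|exact: counit_hom| |].
  by move=> a a_neq0; exists 1; rewrite mulr1 => /counit_eq0.
by move=> b b_neq0; exists 1; rewrite mul1r => /counit_eq0.
Qed.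

End StateModuleFrobenius.

Theorem proposition7p2 (R : realType) (n : nat) (S : completeSemiRingType)
    (C : strictMonoidalCategory) (F : fieldSystem R n)
    (X : topologicalType) (M : closedMfd R n X) :
  frobenius_semialgebra (R := Qtens S C) (A := state F M (Qtens S C))
    (state_scalel F M) (state_scaler F M) (counit F M) /\
  frobenius_semialgebra (R := Qcomp S C) (A := state F M (Qcomp S C))
    (state_scalel F M) (state_scaler F M) (counit F M).
Proof. by split; exact: state_frobenius_semialgebra. Qed.
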